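(* Let $p\equiv 7\pmod 8$ be a prime and suppose that $1+\sqrt2$ generates the group $\mathbb{Z}_p^*/\{1,-1\}$, where $\sqrt2$ denotes a square root of $2$ in $\mathbb{Z}_p$. Then for nonzero $\alpha,\beta\in\mathbb{Z}_p$, an APS$(p,\alpha,\beta)$ exists if and only if $2\alpha^2-\beta^2\equiv 0\pmod p$.
   Context: $\mathbb{Z}_p^*$ is the multiplicative group of nonzero integers modulo $p$ (since $p\equiv 7\pmod 8$, $2$ is a square mod $p$). For an abelian group $(G,+)$ of order $v\equiv 3\pmod 4$ and nonzero $\alpha,\beta\in G$, an APS$(G,\alpha,\beta)$ is a set $\mathcal S$ of $(v-3)/4$ unordered pairs $\{x,y\}$ from $G$ with $\bigcup_{\{x,y\}\in\mathcal S}\pm\{x,y\}=G\setminus\{0,\pm\alpha\}$ and $\bigcup_{\{x,y\}\in\mathcal S}\pm\{x-y,x+y\}=G\setminus\{0,\pm\beta\}$; for $G=\mathbb{Z}_v$ written APS$(v,\alpha,\beta)$. *)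

(* Defs.v *)
From mathcomp Require Import all_boot all_order all_algebra all_fingroup all_solvable.
Set Implicit Arguments.
Unset Strict Implicit.
Unset Printing Implicit Defensive.
Import GRing.Theory.
Local Open Scope ring_scope.

Definition pm (G : finZmodType) (A : {set G}) : {set G} :=
  A :|: [set - x | x in A].

(* An unordered pair {x, y} is a 2-element subset P of G.  In [aps_pm_diffs]
   both orderings (x, y), (y, x) of P occur; they give the same set since
   y - x = - (x - y). *)
Record is_APS (G : finZmodType) (a b : G) (S : {set {set G}}) : Prop := IsAPS {
  aps_order : (#|G| = 3 %[mod 4])%N;
  aps_a_neq0 : a != 0;
  aps_b_neq0 : b != 0;
  aps_card : (#|S| = (#|G| - 3) %/ 4)%N;
  aps_pairs : forall P : {set G}, P \in S -> #|P| = 2;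
  aps_pm_elts : \bigcup_(P in S) pm P = ~: [set 0; a; - a];
  aps_pm_diffs :
    \bigcup_(P in S) \bigcup_(x in P) \bigcup_(y in P | y != x)
      pm [set x - y; x + y] = ~: [set 0; b; - b]
}.

Definition pm1 (F : finFieldType) : {set {unit F}} :=
  [set u | (FinRing.uval u == 1) || (FinRing.uval u == - 1)].

Lemma pm1_group_set (F : finFieldType) : group_set (pm1 F).
Proof.
apply/group_setP; split; first by rewrite inE eqxx.
move=> u v; rewrite !inE /=.
by move=> /orP[]/eqP-> /orP[]/eqP->; rewrite ?mulrNN ?mul1r ?mulr1 !eqxx ?orbT.
Qed.

Canonical pm1_group (F : finFieldType) := Group (pm1_group_set F).

(* Main.v *)
(** Put [g = 1 + s], where [s] is the square root of 2.  Since [g + 1 = s g] and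
    [g - 1 = s], the pair {x, g x} has sum and difference {s g x, s x} up to
    sign: the differences are the elements scaled by [s].  As [g] generates the
    units modulo {1, -1}, a cyclic group of odd order [2N + 1], pairing
    consecutive powers in [a g, a g^2, ..., a g^(2N)] omits exactly [a] among
    the elements and [s a] among the differences, up to sign.  Conversely,
    counting shows that no element is covered twice, and
    (x - y)^2 + (x + y)^2 = 2 (x^2 + y^2) then compares the sums of squares of
    the two covered sets, which are [- 2 a^2] and [- 2 b^2]. *)
Require Import Defs.
From mathcomp Require Import all_boot all_order all_algebra all_fingroup all_solvable.
From mathcomp Require Import zify ring.
Import GRing.Theory.
Local Open Scope ring_scope.

(** * Signed sets and unordered pairs *)

Lemma in_pm (G : finZmodType) (A : {set G}) z :
  (z \in pm A) = (z \in A) || (- z \in A).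
Proof.
rewrite inE; congr (_ || _); apply/imsetP/idP => [[x xA ->]|zA].
  by rewrite opprK.
by exists (- z); rewrite ?opprK.
Qed.

Lemma card_compl_pm (G : finZmodType) (c : G) : c != 0 -> c != - c ->
  #|~: [set 0; c; - c]| = (#|G| - 3)%N.
Proof.
move=> c0 cN; rewrite cardsCs setCK -setUA cardsU1 cards2 cN !inE !(eq_sym 0).
by rewrite oppr_eq0 (negbTE c0).
Qed.

Lemma bigcup_pm_diffs (G : finZmodType) (x y : G) : x != y ->
  \bigcup_(x' in [set x; y]) \bigcup_(y' in [set x; y] | y' != x')
      pm [set x' - y'; x' + y'] = pm [set x - y; x + y].
Proof.
move=> xy; apply/setP=> z; apply/bigcupP/idP => [[x' x'P]|zP].
  case/bigcupP=> y' /andP[y'P yx']; move: x'P y'P yx'; rewrite !in_set2.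
  move=> /orP[]/eqP-> /orP[]/eqP->; rewrite ?eqxx // => _.
  rewrite !in_pm !in_set2 !(eqr_oppLR z) !opprB (addrC y x).
  case: (z == x - y); case: (z == y - x); case: (z == x + y) => //=;
    by case: (z == - (x + y)).
exists x; first by rewrite !inE eqxx.
by apply/bigcupP; exists y => //; rewrite !inE eqxx orbT eq_sym.
Qed.

(** Names the two elements of a pair as functions of the pair, so that sums over the pairs can be
    formed; the default [x0] is never reached. *)
Lemma set2_nth_enum (T : finType) (x0 : T) (P : {set T}) : #|P| = 2 ->
  P = [set nth x0 (enum P) 0; nth x0 (enum P) 1]
  /\ nth x0 (enum P) 0 != nth x0 (enum P) 1.
Proof.
move=> P2; have := enum_uniq P; have := mem_enum P; move: P2; rewrite cardE.
case: (enum P) => [|x [|y []]] //= _ memP /andP[]; rewrite inE => xy _.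
by split=> //; apply/setP=> z; rewrite -memP !inE.
Qed.

(** * Necessity, by sums of squares *)

Section SumSquares.
Variable F : finFieldType.

(** The list [L] of all [f i], [- f i], [g i], [- g i] contains [T] and is no longer than [T]. Hence
    it enumerates [T] without repetition, and each index contributes its two squares twice. *)
Lemma sum_sqr_pm_cover (I : eqType) (r : seq I) (f g : I -> F) (T : {set F}) :
    (forall z, z \in T -> exists2 i, i \in r & z \in pm [set f i; g i]) ->
    (4 * size r <= #|T|)%N ->
  \sum_(z in T) z ^+ 2 = 2%:R * \sum_(i <- r) (f i ^+ 2 + g i ^+ 2).
Proof.
move=> cov szT.
pose L := flatten [seq [:: f i; - f i; g i; - g i] | i <- r].
have szL : size L = (4 * size r)%N.
  by rewrite /L; elim: r {L cov szT} => //= i r ->; rewrite mulnS.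
have TL : {subset enum T <= L}.
  move=> z; rewrite mem_enum => /cov[i ir]; rewrite in_pm !inE => zi.
  apply/flattenP; exists [:: f i; - f i; g i; - g i]; first exact: map_f.
  rewrite !inE -!(eqr_oppLR z).
  by case/orP: zi => /orP[] ->; rewrite ?orbT.
have sz : (size L <= size (enum T))%N by rewrite szL -cardE.
have [_ eqL] := uniq_min_size (enum_uniq T) TL sz.
have uL := leq_size_uniq (enum_uniq T) TL sz.
rewrite -big_enum (perm_big L) /=; last exact: uniq_perm (enum_uniq T) uL eqL.
rewrite big_flatten big_map /= mulr_sumr; apply: eq_bigr => i _.
by rewrite !big_cons big_nil; ring.
Qed.

Hypothesis two_neq0 : 2%:R != 0 :> F.
Variable s : F.
Hypothesis s_sqrt2 : s ^+ 2 = 2%:R.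

Lemma sqrt2_neq0 : s != 0.
Proof. by apply: contraNneq two_neq0 => s0; rewrite -s_sqrt2 s0 expr0n. Qed.

Lemma neq_oppr (x : F) : x != 0 -> x != - x.
Proof. by move=> x0; rewrite -addr_eq0 -mulr2n -mulr_natl mulf_neq0. Qed.

(* The substitution [x := s x] multiplies the sum by 2. *)
Lemma sum_sqr : \sum_(x : F) x ^+ 2 = 0.
Proof.
have : \sum_(x : F) x ^+ 2 = \sum_(x : F) (s * x) ^+ 2.
  exact: reindex_inj (mulfI sqrt2_neq0).
under [RHS]eq_bigr do rewrite exprMn s_sqrt2.
rewrite -mulr_sumr mulr_natl mulr2n => /esym/eqP.
by rewrite -subr_eq0 addrK => /eqP.
Qed.

Lemma sum_sqr_compl_pm (c : F) : c != 0 ->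
  \sum_(x in ~: [set 0; c; - c]) x ^+ 2 = - (2%:R * c ^+ 2).
Proof.
move=> c0; have := sum_sqr; rewrite (bigID (mem [set 0; c; - c])) /=.
rewrite [in X in _ + X](eq_bigl (mem (~: [set 0; c; - c]))) => [|x]; last first.
  by rewrite /= in_setC.
have memc : c \notin [set - c] by rewrite inE neq_oppr.
have mem0 : 0 \notin c |: [set - c].
  by rewrite !inE !(eq_sym 0) oppr_eq0 negb_or c0.
rewrite -setUA !big_setU1 // big_set1 /= expr0n add0r sqrrN -mulr2n -(mulr_natl (c ^+ 2)).
by move/eqP; rewrite addrC addr_eq0 => /eqP.
Qed.

Lemma APS_sqr (a b : F) (S : {set {set F}}) :
  is_APS a b S -> 2%:R * a ^+ 2 - b ^+ 2 = 0.
Proof.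
case=> F3 a0 b0 cS pairs elts diffs.
pose f (P : {set F}) := nth 0 (enum P) 0.
pose g (P : {set F}) := nth 0 (enum P) 1.
have fgP P : P \in S -> P = [set f P; g P] /\ f P != g P.
  by move/pairs/(set2_nth_enum _ 0).
(* The size of [S] leaves no room for overlaps: four signed elements per pair amount to at most
   [#|F| - 3]. *)
have szS (c : F) : c != 0 -> (4 * size (enum S) <= #|~: [set 0%R; c; - c]|)%N.
  by move=> c0; rewrite card_compl_pm ?neq_oppr // -cardE cS; lia.
have covA z : z \in ~: [set 0; a; - a] ->
    exists2 P, P \in enum S & z \in pm [set f P; g P].
  rewrite -elts => /bigcupP[P PS zP]; exists P; first by rewrite mem_enum.
  by rewrite -(fgP P PS).1.
have covB z : z \in ~: [set 0; b; - b] ->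
    exists2 P, P \in enum S & z \in pm [set f P - g P; f P + g P].
  rewrite -diffs => /bigcupP[P PS zP]; exists P; first by rewrite mem_enum.
  by have [PE fg] := fgP P PS; rewrite -(bigcup_pm_diffs _ _ _ fg) -PE.
have := sum_sqr_pm_cover _ _ _ _ _ covA (szS a a0).
have := sum_sqr_pm_cover _ _ _ _ _ covB (szS b b0).
rewrite !sum_sqr_compl_pm // => sumb suma.
rewrite (eq_bigr (fun P => 2%:R * (f P ^+ 2 + g P ^+ 2))) in sumb; last first.
  by move=> P _; ring.
rewrite -mulr_sumr -suma mulrN in sumb.
(* At this point [sumb] equates [2 b^2] with [4 a^2] up to a common sign, so the goal is reached
   after multiplication by 2. *)
apply: (mulfI two_neq0); apply/eqP.
by rewrite mulr0 mulrBr subr_eq0 -eqr_opp sumb.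
Qed.

End SumSquares.

(** * Sufficiency, by powers of the generator *)

Section Generator.
Variable F : finFieldType.

Lemma unit_pm1_normal : (pm1 F <| [set: {unit F}])%g.
Proof.
by rewrite -sub_abelian_normal ?subsetT ?cyclic_abelian ?field_unit_group_cyclic.
Qed.

(** Turns equality in the quotient into equality up to sign in the field. *)
Lemma coset_pm1_eq (v w : {unit F}) : (coset (pm1 F) v == coset (pm1 F) w) =
  (FinRing.uval v == FinRing.uval w) || (FinRing.uval v == - FinRing.uval w).
Proof.
have Npm x : x \in 'N(pm1 F)%g.
  by apply: subsetP (normal_norm unit_pm1_normal) _ _; rewrite inE.
have w0 : FinRing.uval w != 0 by rewrite -unitfE (valP w).
rewrite eq_mulgV1 -morphV // -morphM //.
transitivity ((v * w^-1)%g \in pm1 F).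
  by apply/eqP/idP => [/coset_idr->|/coset_id].
rewrite inE FinRing.val_unitM FinRing.val_unitV.
by rewrite !(can2_eq (divfK w0) (mulfK w0)) mul1r mulN1r.
Qed.

Hypothesis two_neq0 : 2%:R != 0 :> F.

Lemma card_pm1 : #|pm1 F| = 2%N.
Proof.
have N1 : (-1 : F) \is a GRing.unit by rewrite unitrN1.
suff -> : pm1 F = [set 1%g; FinRing.unit F N1].
  rewrite cards2 (_ : 1%g != _) // -val_eqE; exact: neq_oppr (oner_neq0 F).
by apply/setP=> v; rewrite !inE -!val_eqE.
Qed.

Variable u : {unit F}.
Hypothesis u_gen : generator ([set: {unit F}] / pm1 F)%g (coset (pm1 F) u).

Let g : F := FinRing.uval u.
Let n := #[coset (pm1 F) u]%g.

(** The quotient has order [n] and its kernel has order 2, so there are [2 n] units. *)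
Lemma card_field_gen : #|F| = n.*2.+1.
Proof.
have [_ nG] := andP unit_pm1_normal.
rewrite /n orderE -(eqP u_gen) card_quotient // -mul2n -card_pm1.
rewrite Lagrange ?subsetT // card_finField_unit prednK //.
by apply/card_gt0P; exists 0.
Qed.

Lemma gen_expr_pm (x : F) : x != 0 ->
  exists2 i, (i < n)%N & x \in pm [set g ^+ i].
Proof.
rewrite -unitfE => Ux; pose v := FinRing.unit F Ux.
have : coset (pm1 F) v \in <[coset (pm1 F) u]>%g.
  by rewrite -(eqP u_gen) mem_quotient ?inE.
case/cyclePmin=> i ltin /eqP; have Nu : u \in 'N(pm1 F)%g.
  by apply: subsetP (normal_norm unit_pm1_normal) _ _; rewrite inE.
rewrite -morphX // coset_pm1_eq FinRing.val_unitX /= => xE.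
by exists i; rewrite // in_pm !in_set1 eqr_oppLR.
Qed.

Lemma gen_expr_inj i j : (i < n)%N -> (j < n)%N ->
  g ^+ i \in pm [set g ^+ j] -> i = j.
Proof.
move=> lti ltj; have Nu : u \in 'N(pm1 F)%g.
  by apply: subsetP (normal_norm unit_pm1_normal) _ _; rewrite inE.
rewrite in_pm !in_set1 eqr_oppLR -!FinRing.val_unitX -coset_pm1_eq !morphX //.
by rewrite eq_expg_mod_order !modn_small // => /eqP.
Qed.

Lemma gen_neq0 : g != 0.
Proof. by rewrite -unitfE (valP u). Qed.

Lemma in_pm_scale (c x y : F) : c != 0 ->
  (c * x \in pm [set c * y]) = (x \in pm [set y]).
Proof. by move=> c0; rewrite !in_pm !in_set1 -mulrN !(inj_eq (mulfI c0)). Qed.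

(** After division by [c], each nonzero element is, up to sign, a power of [g] with a unique
    exponent below [n]; the excluded elements 1 and -1 are those of exponent 0. *)
Lemma in_compl_pm_genP (c z : F) : c != 0 ->
  reflect (exists2 i, (0 < i < n)%N & z \in pm [set c * g ^+ i])
          (z \in ~: [set 0; c; - c]).
Proof.
move=> c0; rewrite -(divfK c0 z) mulrC; move: {z}(z / c) => x.
have -> : (c * x \in ~: [set 0; c; - c]) = (x != 0) && (x \notin pm [set 1]).
  rewrite -(in_pm_scale _ _ _ c0) in_pm !inE mulr1 mulf_eq0 (negbTE c0) /=.
  by rewrite -orbA negb_or eqr_oppLR.
apply: (iffP andP) => [[x0 x1]|[i /andP[i0 ltin]]].
  have [i ltin xi] := gen_expr_pm x x0; exists i; last by rewrite in_pm_scale.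
  by rewrite ltin andbT lt0n; apply: contraNneq x1 => i0; rewrite i0 expr0 in xi.
rewrite in_pm_scale // => xi; have gi0 := expf_neq0 i gen_neq0.
split.
  by apply: contraTneq xi => ->; rewrite in_pm !in_set1 oppr0 !(eq_sym 0) orbb.
apply: contraTN xi => x1; apply: contraTN i0 => xi; rewrite -eqn0Ngt; apply/eqP.
apply: gen_expr_inj => //; first exact: leq_ltn_trans ltin.
move: x1 xi; rewrite expr0 !in_pm !in_set1 !eqr_oppLR.
by move=> /orP[]/eqP-> /orP[]/eqP e; rewrite -?e ?eqxx ?orbT //
  -[g ^+ i]opprK -e ?opprK eqxx ?orbT.
Qed.

(** For [k < N] the exponents run once through 1, ..., [2 N]. The factor [c] is [a] for the elements
    and [s * a] for the differences. *)
Definition gen_pair (c : F) (k : nat) : {set F} :=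
  [set c * g ^+ k.*2.+1; c * g ^+ k.*2.+2].

Lemma bigcup_pm_gen_pair (N : nat) (c : F) : n = N.*2.+1 -> c != 0 ->
  \bigcup_(k < N) pm (gen_pair c k) = ~: [set 0; c; - c].
Proof.
move=> nE c0; apply/setP=> z; have pairE k : (z \in pm (gen_pair c k)) =
    (z \in pm [set c * g ^+ k.*2.+1]) || (z \in pm [set c * g ^+ k.*2.+2]).
  by rewrite !in_pm !inE orbACA.
apply/bigcupP/(in_compl_pm_genP _ _ c0) => [[k _]|[i i_int zi]].
  have ltk := ltn_ord k.
  by rewrite pairE => /orP[] zk; [exists k.*2.+1|exists k.*2.+2] => //; lia.
(* Exponents start at 1, so [i] belongs to the pair of index [(i - 1) / 2]. *)
have ltk : (i.-1./2 < N)%N by lia.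
exists (Ordinal ltk) => //; rewrite pairE /=.
have [/eqP iE|/eqP iE] : i = i.-1./2.*2.+1 \/ i = i.-1./2.*2.+2 by lia.
  by rewrite -(eqP iE) zi.
by rewrite -(eqP iE) zi orbT.
Qed.

Lemma gen_pair_neq (N k : nat) (c : F) : n = N.*2.+1 -> c != 0 -> (k < N)%N ->
  c * g ^+ k.*2.+1 != c * g ^+ k.*2.+2.
Proof.
move=> nE c0 ltk; rewrite (inj_eq (mulfI c0)); apply/negP => /eqP eqg.
suff: k.*2.+1 = k.*2.+2 by lia.
by apply: gen_expr_inj; rewrite ?in_pm ?in_set1 ?eqg ?eqxx //; lia.
Qed.

Lemma gen_pair_inj (N j k : nat) (c : F) : n = N.*2.+1 -> c != 0 ->
  (j < N)%N -> (k < N)%N -> gen_pair c j = gen_pair c k -> j = k.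
Proof.
move=> nE c0 ltj ltk /setP/(_ (c * g ^+ j.*2.+1)); rewrite !in_set2 eqxx /=.
rewrite !(inj_eq (mulfI c0)) => /esym/orP[]/eqP eqg.
  suff: j.*2.+1 = k.*2.+1 by lia.
  by apply: gen_expr_inj; rewrite ?in_pm ?in_set1 ?eqg ?eqxx //; lia.
(* A match with the second element of the other pair is excluded by parity. *)
suff: j.*2.+1 = k.*2.+2 by lia.
by apply: gen_expr_inj; rewrite ?in_pm ?in_set1 ?eqg ?eqxx //; lia.
Qed.

Lemma gen_APS (s a b : F) : s ^+ 2 = 2%:R -> g = 1 + s ->
    (#|F| = 3 %[mod 4])%N -> a != 0 -> b != 0 ->
    2%:R * a ^+ 2 - b ^+ 2 = 0 ->
  exists S : {set {set F}}, is_APS a b S.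
Proof.
move=> s2 gE F3 a0 b0 ab; have s0 := sqrt2_neq0 _ two_neq0 _ s2.
have cardF := card_field_gen.
(* [n] is odd because [2 n + 1] is 3 modulo 4. *)
have [N nE] : exists N, n = N.*2.+1 by exists n./2; lia.
have injP : injective (fun k : 'I_N => gen_pair a k).
  by move=> j k /(gen_pair_inj _ _ _ _ nE a0 (ltn_ord j) (ltn_ord k))/val_inj.
exists [set gen_pair a k | k : 'I_N]; split=> //.
- by rewrite card_imset // card_ord cardF nE; lia.
- move=> P /imsetP[k _ ->].
  by rewrite cards2 (gen_pair_neq _ _ _ nE a0 (ltn_ord k)).
- by rewrite -(bigcup_pm_gen_pair _ _ nE a0) big_imset //; exact: in2W injP.
(* The hypothesis reads [b^2 = (s a)^2], and the set does not depend on the sign of [b]. *)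
have -> : [set 0; b; - b] = [set 0; s * a; - (s * a)].
  have : (b == s * a) || (b == - (s * a)).
    by rewrite -eqf_sqr exprMn s2 eq_sym -subr_eq0 ab.
  by case/orP=> /eqP->; rewrite ?opprK // -!setUA (setUC [set - _]).
rewrite -(bigcup_pm_gen_pair _ _ nE (mulf_neq0 s0 a0)) big_imset; last exact: in2W injP.
apply: eq_bigr => k _; rewrite bigcup_pm_diffs ?(gen_pair_neq _ _ _ nE) //.
(* Since [1 - g = - s] and [1 + g = s g], the difference and sum of the pair form, up to sign, the
   pair of the same index scaled by [s]. *)
have -> : a * g ^+ k.*2.+1 - a * g ^+ k.*2.+2 = - (s * a * g ^+ k.*2.+1).
  by rewrite (exprS _ k.*2.+1) gE; ring.
have -> : a * g ^+ k.*2.+1 + a * g ^+ k.*2.+2 = s * a * g ^+ k.*2.+2.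
  have g1 : 1 + g = s * g by rewrite gE mulrDr mulr1 -expr2 s2; ring.
  rewrite (exprS _ k.*2.+1); move: (g ^+ _) => w.
  by rewrite -mulrDr -{1}[w]mul1r -mulrDl g1 !mulrA (mulrC a).
apply/setP=> z; rewrite !in_pm !in_set2 !(eqr_oppLR z) opprK.
by rewrite [LHS]orbACA [in LHS](orbC (z == - _)) -orbACA.
Qed.

End Generator.

Theorem theorem4p5 (p : nat) (p_prime : prime p) (p_mod8 : (p = 7 %[mod 8])%N)
    (s : 'F_p) (s_sqrt2 : s ^+ 2 = 2%:R)
    (u : {unit 'F_p}) (u_def : FinRing.uval u = 1 + s)
    (u_gen : generator ([set: {unit 'F_p}] / pm1 'F_p)%g (coset (pm1 'F_p) u))
    (a b : 'F_p) (a_neq0 : a != 0) (b_neq0 : b != 0) :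
  (exists S : {set {set 'F_p}}, is_APS a b S) <-> 2%:R * a ^+ 2 - b ^+ 2 = 0.
Proof.
have two_neq0 : 2%:R != 0 :> 'F_p.
  rewrite -(dvdn_pcharf (pchar_Fp p_prime)) dvdn_prime2 //.
  by apply: contra_eqN p_mod8 => /eqP->.
have F3 : (#|'F_p| = 3 %[mod 4])%N by rewrite card_Fp //; lia.
split=> [[S]|]; first exact: APS_sqr s_sqrt2 _ _ _.
exact: (gen_APS _ two_neq0 _ u_gen _ _ _ s_sqrt2 u_def F3 a_neq0 b_neq0).
Qed.
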